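(* The class of extended Clifford algebras is closed under tensor product: for every integer $k\ge 1$ and all nonnegative integers $r_j,s_j,p_j,q_j$ ($j=1,\dots,k$) there exist nonnegative integers $r,s,p,q$ such that $$r+s+p+q=\sum_{j=1}^k (r_j+s_j+p_j+q_j)$$ and the tensor product $$\mathcal{C}\!\ell(r_1,s_1|p_1,q_1)\otimes\cdots\otimes\mathcal{C}\!\ell(r_k,s_k|p_k,q_k)$$ is isomorphic, as a real algebra, to the extended Clifford algebra $\mathcal{C}\!\ell(r,s|p,q)$.
   Context: All algebras are real, associative and unital; $\otimes$ is the ordinary (ungraded) tensor product over $\mathbb{R}$ with multiplication $(A_1\otimes B_1)(A_2\otimes B_2)=(A_1A_2)\otimes(B_1B_2)$. For nonnegative integers $p,q$ with $n=p+q\ge 1$, $\mathcal{C}\!\ell(p,q)$ is the real Clifford algebra of signature $(p,q)$: it has dimension $2^n$, identity $e$, and generators $e^1,\dots,e^n$ with $e^ae^b+e^be^a=0$ for $a\ne b$, $(e^a)^2=e$ for $a=1,\dots,p$, and $(e^a)^2=-e$ for $a=p+1,\dots,n$. Also $\mathcal{C}\!\ell(0,0)=\mathbb{R}$. For nonnegative integers $p,q$ with $n=p+q\ge 1$, $\mathcal{K}(p,q)$ is the commutative real algebra of dimension $2^n$ with identity $e$ and generators $e^1,\dots,e^n$ with $e^ae^b-e^be^a=0$ for $a\neq b$, $(e^a)^2=e$ for $a=1,\dots,p$, and $(e^a)^2=-e$ for $a=p+1,\dots,n$. Also $\mathcal{K}(0,0)=\mathbb{R}$. The extended Clifford algebra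 is $\mathcal{C}\!\ell(r,s|p,q):=\mathcal{K}(r,s)\otimes\mathcal{C}\!\ell(p,q)$. *)

(* Defs.v *)
From HB Require Import structures.
From mathcomp Require Import all_boot all_order all_algebra all_field.
From mathcomp Require Import reals.
Set Implicit Arguments.
Unset Strict Implicit.
Unset Printing Implicit Defensive.
Import Order.TTheory GRing.Theory Num.Theory.
Local Open Scope ring_scope.

(* Real algebras are [falgType R] (finite-dimensional, associative, unital)   *)
(* with [R : realType], and morphisms of real algebras are [{lrmorphism _}].  *)
(* The constructions below make sense over any field F.                       *)

Section BilinearMultiplication.

(* A multiplication on V given by its values m i j on pairs of elements of a  *)
(* basis e, where c x i is the coordinate of x along e i.                     *)

Variables (F : fieldType) (V : lmodType F) (I : finType).
Variables (e : I -> V) (c : V -> I -> F) (m : I -> I -> V).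
Hypothesis c_linear : forall i a x y, c (a *: x + y) i = a * c x i + c y i.
Hypothesis c_e : forall i j, c (e i) j = (i == j)%:R.
Hypothesis c_sum : forall x, x = \sum_i c x i *: e i.

Definition bilin_mul (x y : V) : V :=
  \sum_i \sum_j (c x i * c y j) *: m i j.

Lemma linear_ext_basis (W : lmodType F) (f g : V -> W) :
  linear f -> linear g -> (forall i, f (e i) = g (e i)) -> f =1 g.
Proof.
move=> fL gL fg x.
pose f' : {linear V -> W} := HB.pack f (GRing.isLinear.Build F V W *:%R f fL).
pose g' : {linear V -> W} := HB.pack g (GRing.isLinear.Build F V W *:%R g gL).
change (f' x = g' x); rewrite (c_sum x) !linear_sum.
by apply: eq_bigr => i _; rewrite !linearZ /= fg.
Qed.

Lemma bilin_mul_linear_l y : linear (bilin_mul^~ y).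
Proof.
move=> a x x'; rewrite /bilin_mul scaler_sumr -big_split; apply: eq_bigr => i _.
rewrite /= scaler_sumr -big_split; apply: eq_bigr => j _ /=.
by rewrite c_linear mulrDl scalerDl -mulrA scalerA.
Qed.

Lemma bilin_mul_linear_r x : linear (bilin_mul x).
Proof.
move=> a y y'; rewrite /bilin_mul scaler_sumr -big_split; apply: eq_bigr => i _.
rewrite /= scaler_sumr -big_split; apply: eq_bigr => j _ /=.
by rewrite c_linear mulrDr scalerDl mulrCA scalerA.
Qed.

Lemma bilin_mul_basis i j : bilin_mul (e i) (e j) = m i j.
Proof.
rewrite /bilin_mul (bigD1 i) //= (bigD1 j) //= !c_e !eqxx mulr1 scale1r.
rewrite big1 ?addr0 => [|l lj]; last first.
  by rewrite c_e eq_sym (negPf lj) mulr0 scale0r.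
rewrite big1 ?addr0 // => l li; apply: big1 => l' _.
by rewrite c_e eq_sym (negPf li) mul0r scale0r.
Qed.

Lemma bilin_mulDl : left_distributive bilin_mul +%R.
Proof. by move=> x y z; have := bilin_mul_linear_l z 1 x y; rewrite !scale1r. Qed.

Lemma bilin_mulDr : right_distributive bilin_mul +%R.
Proof. by move=> x y z; have := bilin_mul_linear_r x 1 y z; rewrite !scale1r. Qed.

Lemma bilin_mulZl a x y : a *: bilin_mul x y = bilin_mul (a *: x) y.
Proof.
have z0 : bilin_mul 0 y = 0.
  by apply: (addrI (bilin_mul 0 y)); rewrite -bilin_mulDl !addr0.
by have := bilin_mul_linear_l y a x 0; rewrite z0 !addr0.
Qed.

Lemma bilin_mulZr a x y : a *: bilin_mul x y = bilin_mul x (a *: y).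
Proof.
have z0 : bilin_mul x 0 = 0.
  by apply: (addrI (bilin_mul x 0)); rewrite -bilin_mulDr !addr0.
by have := bilin_mul_linear_r x a y 0; rewrite z0 !addr0.
Qed.

Lemma bilin_mulA :
  (forall i j k, bilin_mul (e i) (m j k) = bilin_mul (m i j) (e k)) ->
  associative bilin_mul.
Proof.
move=> eA x y z; move: x; apply: linear_ext_basis => [a x x'|a x x'|i].
- exact: bilin_mul_linear_l.
- by rewrite !bilin_mul_linear_l.
move: y; apply: linear_ext_basis => [a y y'|a y y'|j].
- by rewrite bilin_mul_linear_l bilin_mul_linear_r.
- by rewrite bilin_mul_linear_r bilin_mul_linear_l.
move: z; apply: linear_ext_basis => [a z z'|a z z'|k].
- by rewrite !bilin_mul_linear_r.
- exact: bilin_mul_linear_r.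
by rewrite !bilin_mul_basis.
Qed.

Lemma bilin_mul1l u :
  (forall i, bilin_mul u (e i) = e i) -> left_id u bilin_mul.
Proof. by move=> ue; apply: linear_ext_basis => //; exact: bilin_mul_linear_r. Qed.

Lemma bilin_mul1r u :
  (forall i, bilin_mul (e i) u = e i) -> right_id u bilin_mul.
Proof. by move=> ue; apply: linear_ext_basis => //; exact: bilin_mul_linear_l. Qed.

End BilinearMultiplication.

Section SymmetricDifference.

Variable T : finType.

Definition symdiff (A B : {set T}) : {set T} := (A :\: B) :|: (B :\: A).

Lemma in_symdiff A B i : (i \in symdiff A B) = (i \in A) (+) (i \in B).
Proof. by rewrite !inE; case: (i \in A); case: (i \in B). Qed.

Lemma symdiffA : associative symdiff.
Proof. by move=> A B C; apply/setP=> i; rewrite !in_symdiff addbA. Qed.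

Lemma symdiffC : commutative symdiff.
Proof. by move=> A B; apply/setP=> i; rewrite !in_symdiff addbC. Qed.

Lemma symdiff0 A : symdiff A set0 = A.
Proof. by apply/setP=> i; rewrite in_symdiff inE addbF. Qed.

Lemma prod_symdiff (F : fieldType) (g : T -> F) A B :
  (forall i, g i * g i = 1) ->
  \prod_(i in symdiff A B) g i = (\prod_(i in A) g i) * \prod_(i in B) g i.
Proof.
move=> g2; rewrite big_mkcond [X in X * _]big_mkcond [X in _ * X]big_mkcond.
rewrite -big_split /=; apply: eq_bigr => i _.
by rewrite in_symdiff; case: (i \in A); case: (i \in B); rewrite ?g2 ?mulr1 ?mul1r.
Qed.

End SymmetricDifference.

(* The algebra with generators e^0, ..., e^(n-1) and basis (e^A), A a set of  *)
(* indices, in which e^A is the product of the e^a, a in A, in increasing     *)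
(* order.  Computing e^A * e^B means moving each e^b (b in B) leftwards past  *)
(* the e^a (a in A); beta a b tells whether the pair (a, b) contributes a     *)
(* factor -1: for a > b, when e^a and e^b anticommute; for a = b, when        *)
(* (e^a)^2 = -1; never for a < b.                                             *)

Definition sign_alg (F : fieldType) (n : nat) (beta : rel 'I_n) : Type :=
  {ffun {set 'I_n} -> F^o}.

Section SignAlgebra.

Variables (F : fieldType) (n : nat) (beta : rel 'I_n).
Local Notation sign_alg := (sign_alg F beta).

HB.instance Definition _ :=
  Vector.copy sign_alg {ffun {set 'I_n} -> F^o}.

Definition blade (A : {set 'I_n}) : sign_alg :=
  [ffun B => (A == B)%:R] : {ffun {set 'I_n} -> F^o}.

Definition blade_coord (x : sign_alg) (A : {set 'I_n}) : F :=
  (x : {ffun {set 'I_n} -> F^o}) A.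

Definition blade_sign (A B : {set 'I_n}) : F :=
  \prod_(a in A) \prod_(b in B) (-1) ^+ beta a b.

Definition sign_mul : sign_alg -> sign_alg -> sign_alg :=
  bilin_mul blade_coord (fun A B => blade_sign A B *: blade (symdiff A B)).

Lemma blade_coord_linear A a x y :
  blade_coord (a *: x + y) A = a * blade_coord x A + blade_coord y A.
Proof. by rewrite /blade_coord !ffunE. Qed.

Lemma blade_coordZ A a x : blade_coord (a *: x) A = a * blade_coord x A.
Proof. by rewrite /blade_coord !ffunE. Qed.

Lemma blade_coord_blade A B : blade_coord (blade A) B = (A == B)%:R.
Proof. by rewrite /blade_coord ffunE. Qed.

Lemma blade_coord_sum x : x = \sum_A blade_coord x A *: blade A.
Proof.
apply/ffunP=> B; rewrite -[LHS]/(blade_coord x B) -[RHS]/(blade_coord _ B).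
have cL : linear (blade_coord^~ B : sign_alg -> F^o).
  by move=> a y z; rewrite blade_coord_linear.
pose c : {linear sign_alg -> F^o} :=
  HB.pack (blade_coord^~ B) (GRing.isLinear.Build F sign_alg F^o *:%R _ cL).
rewrite -[RHS]/(c _) linear_sum (bigD1 B) //= blade_coordZ.
rewrite blade_coord_blade eqxx mulr1 big1 ?addr0 // => A AB.
by rewrite blade_coordZ blade_coord_blade (negPf AB) mulr0.
Qed.

Lemma sign_sqr (b : bool) : (-1 : F) ^+ b * (-1) ^+ b = 1.
Proof. by rewrite -signr_addb addbb. Qed.

Lemma blade_signDl A A' B :
  blade_sign (symdiff A A') B = blade_sign A B * blade_sign A' B.
Proof.
apply: prod_symdiff => a; rewrite -big_split big1 //= => b _; exact: sign_sqr.
Qed.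

Lemma blade_signDr A B B' :
  blade_sign A (symdiff B B') = blade_sign A B * blade_sign A B'.
Proof.
rewrite -big_split; apply: eq_bigr => a _; apply: prod_symdiff => b.
exact: sign_sqr.
Qed.

Lemma blade_sign0l B : blade_sign set0 B = 1.
Proof. by rewrite /blade_sign big_set0. Qed.

Lemma blade_sign0r A : blade_sign A set0 = 1.
Proof. by rewrite /blade_sign big1 // => a _; rewrite big_set0. Qed.

Let mulB := bilin_mul_basis
  (fun A B => blade_sign A B *: blade (symdiff A B)) blade_coord_blade.

Lemma sign_mul_blade A B :
  sign_mul (blade A) (blade B) = blade_sign A B *: blade (symdiff A B).
Proof. exact: mulB. Qed.

Lemma sign_mulA : associative sign_mul.
Proof.
apply: bilin_mulA blade_coord_linear blade_coord_blade blade_coord_sum _.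
move=> A B C; rewrite -bilin_mulZr ?mulB; last exact: blade_coord_linear.
rewrite -bilin_mulZl ?mulB; last exact: blade_coord_linear.
rewrite !scalerA blade_signDl blade_signDr symdiffA; congr (_ *: _).
by rewrite mulrC -?mulrA.
Qed.

Lemma sign_mul1l : left_id (blade set0) sign_mul.
Proof.
apply: bilin_mul1l blade_coord_linear blade_coord_sum _ _ => A.
by rewrite mulB blade_sign0l scale1r symdiffC symdiff0.
Qed.

Lemma sign_mul1r : right_id (blade set0) sign_mul.
Proof.
apply: bilin_mul1r blade_coord_linear blade_coord_sum _ _ => A.
by rewrite mulB blade_sign0r scale1r symdiff0.
Qed.

Lemma blade0_neq0 : blade set0 != 0.
Proof.
apply/eqP => /(congr1 (fun x => blade_coord x set0)).
rewrite blade_coord_blade eqxx /blade_coord ffunE => /eqP.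
by rewrite oner_eq0.
Qed.

HB.instance Definition _ := GRing.Zmodule_isNzRing.Build sign_alg
  sign_mulA sign_mul1l sign_mul1r
  (bilin_mulDl _ blade_coord_linear) (bilin_mulDr _ blade_coord_linear)
  blade0_neq0.

HB.instance Definition _ := GRing.Lmodule_isLalgebra.Build F sign_alg
  (bilin_mulZl _ blade_coord_linear).

HB.instance Definition _ := GRing.Lalgebra_isAlgebra.Build F sign_alg
  (bilin_mulZr _ blade_coord_linear).

HB.instance Definition _ := Algebra_isFalgebra.Build F sign_alg.

End SignAlgebra.

Arguments blade F {n} beta A.
Arguments blade_sign F {n} beta A B.

Section SignAlgebraTheory.

Variables (F : fieldType) (n : nat) (beta : rel 'I_n).
Local Notation blade := (blade F beta).

Definition sign_gen (a : 'I_n) : sign_alg F beta := blade [set a].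

Lemma dim_sign_alg : \dim {:sign_alg F beta} = (2 ^ n)%N.
Proof.
by rewrite dimvf -[RHS]muln1 -[n in (2 ^ n)%N]card_ord -cardsT -card_powerset
           powersetT cardsT.
Qed.

Lemma bladeM A B :
  blade A * blade B = blade_sign F beta A B *: blade (symdiff A B).
Proof. exact: sign_mul_blade. Qed.

Lemma blade0 : blade set0 = 1. Proof. by []. Qed.

Lemma blade_sign1 a b : blade_sign F beta [set a] [set b] = (-1) ^+ beta a b.
Proof. by rewrite /blade_sign !big_set1. Qed.

Lemma sign_gen_sqr a : sign_gen a * sign_gen a = ((-1) ^+ beta a a)%:A.
Proof.
rewrite bladeM blade_sign1 -blade0; congr (_ *: blade _).
by apply/setP=> i; rewrite in_symdiff addbb inE.
Qed.

Lemma sign_gen_swap a b :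
  sign_gen a * sign_gen b =
  (-1) ^+ (beta a b (+) beta b a) *: (sign_gen b * sign_gen a).
Proof.
by rewrite !bladeM !blade_sign1 scalerA -signr_addb -addbA addbb addbF symdiffC.
Qed.

Lemma blade_prod (A : {set 'I_n}) :
  (forall a b : 'I_n, (a < b)%N -> beta a b = false) ->
  blade A = \prod_(a <- enum A) sign_gen a.
Proof.
move=> beta_tri.
have: sorted (relpre (@nat_of_ord n) ltn) (enum A).
  rewrite -sorted_map; apply: (@subseq_sorted _ ltn) (iota_ltn_sorted 0 n).
    exact: ltn_trans.
  by rewrite -val_enum_ord map_subseq // enumT filter_subseq.
have -> : blade A = blade [set a in enum A].
  by congr blade; apply/setP=> a; rewrite inE mem_enum.
elim: (enum A) => [_|a s IHs]; first by rewrite big_nil -blade0 set_nil.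
rewrite [sorted _ _]/= => a_s; rewrite big_cons -IHs ?(path_sorted a_s) //.
have lt_as : all (fun b : 'I_n => (a < b)%N) s.
  by apply: order_path_min a_s => x y z; exact: ltn_trans.
rewrite bladeM /blade_sign big_set1 big1 => [|b]; last first.
  by rewrite inE => sb; rewrite beta_tri // (allP lt_as).
rewrite scale1r; congr blade; apply/setP=> b; rewrite in_symdiff !inE.
case: eqP => [->|//]; case: (boolP (a \in s)) => // sa.
by have := allP lt_as _ sa; rewrite ltnn.
Qed.

End SignAlgebraTheory.

Section CliffordAlgebras.

(* Generators are numbered from 0, so that e^a squares to 1 when a < p and    *)
(* to -1 when p <= a < p + q.                                                 *)

Variable F : fieldType.

Definition clifford_sign p q : rel 'I_(p + q) :=
  fun a b => (b < a)%N || (a == b) && (p <= a)%N.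

Definition commutative_sign p q : rel 'I_(p + q) :=
  fun a b => (a == b) && (p <= a)%N.

Definition clifford p q : falgType F := sign_alg F (@clifford_sign p q).

Definition kalg p q : falgType F := sign_alg F (@commutative_sign p q).

Definition clifford_gen p q (a : 'I_(p + q)) : clifford p q := sign_gen F _ a.

Definition kalg_gen p q (a : 'I_(p + q)) : kalg p q := sign_gen F _ a.

Lemma dim_clifford p q : \dim {:clifford p q} = (2 ^ (p + q))%N.
Proof. exact: dim_sign_alg. Qed.

Lemma dim_kalg p q : \dim {:kalg p q} = (2 ^ (p + q))%N.
Proof. exact: dim_sign_alg. Qed.

Lemma clifford_gen_anticomm p q (a b : 'I_(p + q)) : a != b ->
  clifford_gen a * clifford_gen b + clifford_gen b * clifford_gen a = 0.
Proof.
move=> ab; apply/eqP; rewrite addr_eq0 /clifford_gen sign_gen_swap.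
rewrite /clifford_sign [b == a]eq_sym (negPf ab) !orbF.
by move: ab; rewrite -val_eqE /=; case: ltngtP => //= _ _; rewrite scaleN1r.
Qed.

Lemma clifford_gen_sqr p q (a : 'I_(p + q)) :
  clifford_gen a * clifford_gen a = if (a < p)%N then 1 else -1.
Proof.
rewrite /clifford_gen sign_gen_sqr /clifford_sign ltnn eqxx /= leqNgt.
by case: (a < p)%N; rewrite ?scale1r ?scaleN1r.
Qed.

Lemma clifford_blade_prod p q (A : {set 'I_(p + q)}) :
  blade F _ A = \prod_(a <- enum A) clifford_gen a.
Proof.
apply: blade_prod => a b ab; rewrite /clifford_sign ltnNge ltnW //=.
by case: eqP ab => // ->; rewrite ltnn.
Qed.

Lemma kalg_mulC p q (x y : kalg p q) : x * y = y * x.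
Proof.
have blC A B : (blade F (@commutative_sign p q) A * blade F _ B : kalg p q) =
               blade F _ B * blade F _ A.
  rewrite !bladeM symdiffC; congr (_ *: _); rewrite /blade_sign exchange_big.
  apply: eq_bigr => b _; apply: eq_bigr => a _; rewrite /commutative_sign.
  by rewrite eq_sym; case: eqP => // ->.
rewrite (blade_coord_sum x) (blade_coord_sum y) mulr_suml [RHS]mulr_sumr.
apply: eq_bigr => A _; rewrite mulr_sumr mulr_suml; apply: eq_bigr => B _.
by rewrite -!scalerAl -!scalerAr blC !scalerA mulrC.
Qed.

Lemma kalg_gen_sqr p q (a : 'I_(p + q)) :
  kalg_gen a * kalg_gen a = if (a < p)%N then 1 else -1.
Proof.
rewrite /kalg_gen sign_gen_sqr /commutative_sign eqxx /= leqNgt.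
by case: (a < p)%N; rewrite ?scale1r ?scaleN1r.
Qed.

Lemma kalg_blade_prod p q (A : {set 'I_(p + q)}) :
  blade F _ A = \prod_(a <- enum A) kalg_gen a.
Proof.
apply: blade_prod => a b ab; rewrite /commutative_sign.
by case: eqP ab => // ->; rewrite ltnn.
Qed.

End CliffordAlgebras.

Section TensorProduct.

Import VectorInternalTheory.

(* The tensor product is realised on coordinate matrices: fixing the bases    *)
(* u_i of A and w_j of B given by the coordinate isomorphisms v2r, the matrix *)
(* M stands for \sum_(i, j) M i j u_i (x) w_j.  Its universal property is     *)
(* tensor_lift and tensor_ext below.                                          *)

Variables (F : fieldType) (A B : falgType F).

Definition tensor : Type := 'M[F]_(dim A, dim B).

HB.instance Definition _ := Vector.copy tensor 'M[F]_(dim A, dim B).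

Definition pure_tensor (u : A) (v : B) : tensor := (v2r u)^T *m v2r v.

Local Notation "u '[*]' v" := (pure_tensor u v) (at level 40).

Definition coord_basis (V : falgType F) (i : 'I_(dim V)) : V :=
  r2v (delta_mx 0 i).

Definition tensor_basis (k : 'I_(dim A) * 'I_(dim B)) : tensor :=
  coord_basis k.1 [*] coord_basis k.2.

Definition tensor_coord (M : tensor) (k : 'I_(dim A) * 'I_(dim B)) : F :=
  (M : 'M[F]_(dim A, dim B)) k.1 k.2.

Definition tensor_mul : tensor -> tensor -> tensor :=
  bilin_mul tensor_coord
    (fun k l => (coord_basis k.1 * coord_basis l.1) [*]
                (coord_basis k.2 * coord_basis l.2)).

Lemma coord_basis_sum (V : falgType F) (x : V) :
  x = \sum_i v2r x 0 i *: coord_basis i.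
Proof.
apply: v2r_inj; rewrite linear_sum {1}[v2r x]row_sum_delta.
by apply: eq_bigr => i _; rewrite linearZ /= r2vK.
Qed.

Lemma pure_linear_l v : linear (pure_tensor^~ v).
Proof.
move=> a u u'; rewrite /pure_tensor !linearP /=.
by rewrite mulmxDl -scalemxAl.
Qed.

Lemma pure_linear_r u : linear (pure_tensor u).
Proof. by move=> a v v'; rewrite /pure_tensor !linearP. Qed.

Lemma tensor_basisE k : tensor_basis k = delta_mx k.1 k.2 :> 'M_(dim A, dim B).
Proof. by rewrite /tensor_basis /pure_tensor !r2vK trmx_delta mul_delta_mx. Qed.

Lemma tensor_coord_linear k a x y :
  tensor_coord (a *: x + y) k = a * tensor_coord x k + tensor_coord y k.
Proof. by rewrite /tensor_coord !mxE. Qed.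

Lemma tensor_coord_basis k l : tensor_coord (tensor_basis k) l = (k == l)%:R.
Proof.
rewrite /tensor_coord tensor_basisE mxE; congr (_%:R); congr (nat_of_bool _).
by case: k l => [i j] [i' j']; rewrite xpair_eqE eq_sym [j == _]eq_sym.
Qed.

Lemma tensor_coord_sum M : M = \sum_k tensor_coord M k *: tensor_basis k.
Proof.
rewrite {1}[M]matrix_sum_delta pair_big; apply: eq_bigr => k _.
by rewrite -tensor_basisE.
Qed.

Let lin_ext (V : falgType F) (W : lmodType F) (f g : V -> W) :
  linear f -> linear g ->
  (forall i, f (coord_basis i) = g (coord_basis i)) -> f =1 g.
Proof.
exact: (linear_ext_basis (c := fun x i => v2r x 0 i) (@coord_basis_sum V)).
Qed.

Let mul_linear_l := bilin_mul_linear_l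
  (fun k l => (coord_basis k.1 * coord_basis l.1) [*]
              (coord_basis k.2 * coord_basis l.2)) tensor_coord_linear.
Let mul_linear_r := bilin_mul_linear_r
  (fun k l => (coord_basis k.1 * coord_basis l.1) [*]
              (coord_basis k.2 * coord_basis l.2)) tensor_coord_linear.

Lemma tensor_mul_pure u v u' v' :
  tensor_mul (u [*] v) (u' [*] v') = (u * u') [*] (v * v').
Proof.
move: u; apply: lin_ext => [a x y|a x y|i].
- by rewrite pure_linear_l; exact: mul_linear_l.
- by rewrite mulrDl -scalerAl pure_linear_l.
move: v; apply: lin_ext => [a x y|a x y|j].
- by rewrite pure_linear_r; exact: mul_linear_l.
- by rewrite mulrDl -scalerAl pure_linear_r.
move: u'; apply: lin_ext => [a x y|a x y|i'].
- by rewrite pure_linear_l; exact: mul_linear_r.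
- by rewrite mulrDr -scalerAr pure_linear_l.
move: v'; apply: lin_ext => [a x y|a x y|j'].
- by rewrite pure_linear_r; exact: mul_linear_r.
- by rewrite mulrDr -scalerAr pure_linear_r.
exact: (bilin_mul_basis _ tensor_coord_basis (i, j) (i', j')).
Qed.

Lemma tensor_mulA : associative tensor_mul.
Proof.
apply: bilin_mulA tensor_coord_linear tensor_coord_basis tensor_coord_sum _.
by move=> k l m; rewrite [LHS]tensor_mul_pure [RHS]tensor_mul_pure !mulrA.
Qed.

Lemma tensor_mul1l : left_id (1 [*] 1) tensor_mul.
Proof.
apply: bilin_mul1l tensor_coord_linear tensor_coord_sum _ _ => k.
by rewrite [LHS]tensor_mul_pure !mul1r.
Qed.

Lemma tensor_mul1r : right_id (1 [*] 1) tensor_mul.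
Proof.
apply: bilin_mul1r tensor_coord_linear tensor_coord_sum _ _ => k.
by rewrite [LHS]tensor_mul_pure !mulr1.
Qed.

Lemma pure_tensor_eq0 u v : (u [*] v == 0) = (u == 0) || (v == 0).
Proof.
apply/eqP/orP => [uv0|[]/eqP->]; last 2 first.
- by rewrite /pure_tensor linear0 trmx0 mul0mx.
- by rewrite /pure_tensor linear0 mulmx0.
have [u0|un0] := eqVneq u 0; [by left | right].
have /rV0Pn[i ui] : v2r u != 0.
  by apply: contra un0 => /eqP u0; apply/eqP/v2r_inj; rewrite u0 linear0.
apply/eqP/v2r_inj; rewrite linear0; apply/rowP => j; apply: (mulfI ui).
have /matrixP/(_ i j) := uv0.
by rewrite !mxE big_ord1 !mxE mulr0.
Qed.

Lemma tensor1_neq0 : 1 [*] 1 != 0.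
Proof. by rewrite pure_tensor_eq0 !oner_eq0. Qed.

HB.instance Definition _ := GRing.Zmodule_isNzRing.Build tensor
  tensor_mulA tensor_mul1l tensor_mul1r
  (bilin_mulDl _ tensor_coord_linear) (bilin_mulDr _ tensor_coord_linear)
  tensor1_neq0.

HB.instance Definition _ := GRing.Lmodule_isLalgebra.Build F tensor
  (bilin_mulZl _ tensor_coord_linear).

HB.instance Definition _ := GRing.Lalgebra_isAlgebra.Build F tensor
  (bilin_mulZr _ tensor_coord_linear).

HB.instance Definition _ := Algebra_isFalgebra.Build F tensor.

Lemma pure_tensor1 : 1 [*] 1 = 1. Proof. by []. Qed.

Lemma pure_tensorM u v u' v' :
  (u [*] v) * (u' [*] v') = (u * u') [*] (v * v').
Proof. exact: tensor_mul_pure. Qed.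

Lemma dim_tensor : \dim {:tensor} = (\dim {:A} * \dim {:B})%N.
Proof. by rewrite !dimvf. Qed.

Lemma tensor_ext (W : lmodType F) (f g : {linear tensor -> W}) :
  (forall u v, f (u [*] v) = g (u [*] v)) -> f =1 g.
Proof.
move=> fg; apply: (linear_ext_basis (c := tensor_coord) tensor_coord_sum).
- exact: linearP.
- exact: linearP.
by move=> k; exact: fg.
Qed.

Lemma tensor_lift (W : lmodType F) (g : A -> B -> W) :
  (forall v, linear (g^~ v)) -> (forall u, linear (g u)) ->
  exists f : {linear tensor -> W}, forall u v, f (u [*] v) = g u v.
Proof.
move=> gl gr.
pose f0 (M : tensor) :=
  \sum_k tensor_coord M k *: g (coord_basis k.1) (coord_basis k.2).
have f0L : linear f0.
  move=> a M N; rewrite /f0 scaler_sumr -big_split; apply: eq_bigr => k _ /=.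
  by rewrite tensor_coord_linear scalerDl scalerA.
pose f : {linear tensor -> W} :=
  HB.pack f0 (GRing.isLinear.Build F tensor W *:%R f0 f0L).
have fb k : f (tensor_basis k) = g (coord_basis k.1) (coord_basis k.2).
  rewrite -[LHS]/(f0 _) /f0 (bigD1 k) //= tensor_coord_basis eqxx scale1r.
  rewrite big1 ?addr0 // => l lk.
  by rewrite tensor_coord_basis eq_sym (negPf lk) scale0r.
exists f; move=> u v; move: u; apply: lin_ext => [a x y|a x y|i].
- by rewrite pure_linear_l linearP.
- exact: gl.
move: v; apply: lin_ext => [a x y|a x y|j].
- by rewrite pure_linear_r linearP.
- exact: gr.
exact: (fb (i, j)).
Qed.

End TensorProduct.

(* A_0 (x) ... (x) A_k, bracketed from the left.                              *)
Fixpoint tensor_iter (F : fieldType) (k : nat) :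
    ('I_k.+1 -> falgType F) -> falgType F :=
  match k with
  | 0 => fun A => A ord0
  | k'.+1 => fun A =>
      tensor (tensor_iter (fun j : 'I_k'.+1 => A (widen_ord (leqnSn _) j)))
             (A ord_max)
  end.

Definition ext_clifford (F : fieldType) (r s p q : nat) : falgType F :=
  tensor (kalg F r s) (clifford F p q).

(* Main.v *)
Require Import Defs.
From HB Require Import structures.
From mathcomp Require Import all_boot all_order all_algebra all_field.
From mathcomp Require Import reals.
Import Order.TTheory GRing.Theory Num.Theory.
Local Open Scope ring_scope.

Set Implicit Arguments.
Unset Strict Implicit.
Unset Printing Implicit Defensive.

(* Call a generating family of an algebra a sign system when its members       *)
(* square to 1 or -1, any two of them commute or anticommute, and the          *)
(* dimension is 2^n for n members.  Extended Clifford algebras have sign       *)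
(* systems, and a tensor product inherits one from its factors, so it suffices *)
(* to show that every algebra with a sign system is an extended Clifford       *)
(* algebra.  Multiplying generators by one another preserves the system.  As   *)
(* in symplectic Gram-Schmidt, an anticommuting pair g, h is split off by      *)
(* correcting the remaining generators with g and h so that they commute with  *)
(* both; the pairs are then merged into one pairwise anticommuting family by   *)
(* multiplying each new pair by the product w of the family built so far.      *)
(* What is left over is central and generates the commutative factor.          *)

(** Modulo sign, the products of the members of a sign system of size [n] form a vector space of
    dimension [n] over the field with two elements, and the commutation sign is an alternating form
    on it. Such a form splits into hyperbolic planes and a radical. [anticommuting_extension] finds
    this splitting and turns the planes into one anticommuting family [c]; the radical gives a
    central family [z].

    Conversely, [c] and [z] determine the algebra. By the universal property [sign_alg_lift], they
    define morphisms from a Clifford algebra and from a commutative algebra, whose images commute.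
    [tensor_lift_morph] combines the two into a morphism from an extended Clifford algebra. It is
    onto because [c ++ z] generates, and bijective because both dimensions are [2 ^ n]. The
    parameters thus satisfy the required sum, since [tensor_sign_system] adds the sizes of the
    systems of the factors. *)

Section GeneratedSubalgebra.

Variables (F : fieldType) (A : falgType F).
Implicit Types (s t : seq A) (x y : A).

Inductive adjoin s : A -> Prop :=
  | adjoin1 : adjoin s 1
  | adjoin_mem x : x \in s -> adjoin s x
  | adjoin_lin a x y : adjoin s x -> adjoin s y -> adjoin s (a *: x + y)
  | adjoinM x y : adjoin s x -> adjoin s y -> adjoin s (x * y).

Lemma adjoin0 s : adjoin s 0.
Proof. by rewrite -[0](addNr 1) -scaleN1r; apply: adjoin_lin; exact: adjoin1. Qed.

Lemma adjoinD s x y : adjoin s x -> adjoin s y -> adjoin s (x + y).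
Proof. by rewrite -{2}[x]scale1r; exact: adjoin_lin. Qed.

Lemma adjoinZ s a x : adjoin s x -> adjoin s (a *: x).
Proof. by move=> sx; rewrite -[_ *: _]addr0; apply/adjoin_lin/adjoin0. Qed.

Lemma adjoin_signM s (b : bool) x : adjoin s ((-1) ^+ b * x) -> adjoin s x.
Proof.
by rewrite mulr_sign; case: b => // /(adjoinZ (-1)); rewrite scaleN1r opprK.
Qed.

Lemma adjoinX s x n : adjoin s x -> adjoin s (x ^+ n).
Proof.
by move=> sx; elim: n => [|n IHn]; [exact: adjoin1 | rewrite exprS; exact: adjoinM].
Qed.

Lemma adjoin_sub s t x :
  (forall y, y \in s -> adjoin t y) -> adjoin s x -> adjoin t x.
Proof.
move=> st; elim=> [|y /st //|a y z _ ty _ tz|y z _ ty _ tz].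
- exact: adjoin1.
- exact: adjoin_lin.
- exact: adjoinM.
Qed.

Lemma adjoin_sum s (I : Type) (r : seq I) (P : pred I) (f : I -> A) :
  (forall i, adjoin s (f i)) -> adjoin s (\sum_(i <- r | P i) f i).
Proof.
by move=> sf; apply: big_ind => //; [exact: adjoin0 | exact: adjoinD].
Qed.

Lemma adjoin_prod s (I : Type) (r : seq I) (P : pred I) (f : I -> A) :
  (forall i, adjoin s (f i)) -> adjoin s (\prod_(i <- r | P i) f i).
Proof.
by move=> sf; apply: big_ind => //; [exact: adjoin1 | exact: adjoinM].
Qed.

Lemma adjoin_comm s x y :
  (forall z, z \in s -> GRing.comm x z) -> adjoin s y -> GRing.comm x y.
Proof.
move=> sx; elim=> [|z /sx //|a u v _ xu _ xv|u v _ xu _ xv].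
- exact: commr1.
- by apply: commrD xv; rewrite /GRing.comm -scalerAr xu scalerAl.
- exact: commrM.
Qed.

End GeneratedSubalgebra.

Lemma adjoin_morph (F : fieldType) (A B : falgType F) (f : {lrmorphism A -> B})
    (s : seq A) (x : A) :
  adjoin s x -> adjoin (map f s) (f x).
Proof.
elim=> [|y sy|a y z _ ty _ tz|y z _ ty _ tz].
- by rewrite rmorph1; exact: adjoin1.
- by apply/adjoin_mem/map_f.
- by rewrite linearP; exact: adjoin_lin.
- by rewrite rmorphM; exact: adjoinM.
Qed.

(** * Elements that square to a sign and commute up to sign *)

Section SignCommutation.

Variables (F : fieldType) (A : falgType F).
Implicit Types (s c : seq A) (x y z w : A) (b : bool).

Definition sqr_sign x := (x * x == 1) || (x * x == -1).

(** The sign is stored as a boolean so that, when elements are multiplied, their signs combine by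
    [(+)]. This makes commutation bilinear over the field with two elements. *)
Definition sign_comm b x y := x * y == (-1) ^+ b * (y * x).

Definition pm_comm x y := sign_comm false x y || sign_comm true x y.

Lemma mulr_signCA x b y : x * ((-1) ^+ b * y) = (-1) ^+ b * (x * y).
Proof. by rewrite mulrA commr_sign mulrA. Qed.

Lemma sqr_signP x : reflect (exists b, x * x = (-1) ^+ b) (sqr_sign x).
Proof.
apply: (iffP orP) => [[]/eqP xx|[[]->]]; last 2 first.
- by right.
- by left.
- by exists false.
- by exists true.
Qed.

Lemma pm_commP x y : reflect (exists b, sign_comm b x y) (pm_comm x y).
Proof.
apply: (iffP orP) => [[]|[[]]]; last 2 first.
- by right.
- by left.
- by exists false.
- by exists true.
Qed.

Lemma sign_commFP x y : reflect (GRing.comm x y) (sign_comm false x y).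
Proof. by rewrite /sign_comm expr0 mul1r; exact: eqP. Qed.

Lemma sign_comm_refl x : sign_comm false x x.
Proof. exact/sign_commFP. Qed.

Lemma sign_comm_sym b x y : sign_comm b x y -> sign_comm b y x.
Proof. by move=> /eqP xy; rewrite /sign_comm xy signrMK. Qed.

Lemma pm_comm_sym x y : pm_comm x y -> pm_comm y x.
Proof. by move=> /pm_commP[b] /sign_comm_sym ?; apply/pm_commP; exists b. Qed.

Lemma sign_comm1l x : sign_comm false 1 x.
Proof. exact/sign_commFP/commr_sym/commr1. Qed.

Lemma sign_commMl b b' x y z :
  sign_comm b x z -> sign_comm b' y z -> sign_comm (b (+) b') (x * y) z.
Proof.
move=> /eqP xz /eqP yz; rewrite /sign_comm -mulrA yz mulr_signCA.
by rewrite [x * (z * y)]mulrA xz addbC signr_addb !mulrA.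
Qed.

Lemma sign_commMr b b' x y z :
  sign_comm b z x -> sign_comm b' z y -> sign_comm (b (+) b') z (x * y).
Proof.
by move=> /sign_comm_sym zx /sign_comm_sym zy; apply/sign_comm_sym/sign_commMl.
Qed.

Lemma sign_commXl b (k : bool) x y :
  sign_comm b x y -> sign_comm (k && b) (x ^+ k) y.
Proof. by case: k => //= _; exact: sign_comm1l. Qed.

Lemma pm_commMl x y z : pm_comm x z -> pm_comm y z -> pm_comm (x * y) z.
Proof.
move=> /pm_commP[b xz] /pm_commP[b' yz]; apply/pm_commP; exists (b (+) b').
exact: sign_commMl.
Qed.

Lemma pm_commXl (k : bool) x y : pm_comm x y -> pm_comm (x ^+ k) y.
Proof.
by move=> /pm_commP[b] /(sign_commXl k) xy; apply/pm_commP; exists (k && b).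
Qed.

Lemma sqr_sign1 : sqr_sign 1.
Proof. by rewrite /sqr_sign mulr1 eqxx. Qed.

Lemma sqr_signM x y :
  sqr_sign x -> sqr_sign y -> pm_comm x y -> sqr_sign (x * y).
Proof.
move=> /sqr_signP[b xx] /sqr_signP[b' yy] /pm_commP[d /eqP xy].
apply/sqr_signP; exists (d (+) (b' (+) b)); rewrite {2}xy mulr_signCA -[x * y * _]mulrA.
by rewrite [y * _]mulrA yy mulr_signCA xx -!signr_addb.
Qed.

Lemma sqr_signX (k : bool) x : sqr_sign x -> sqr_sign (x ^+ k).
Proof. by case: k => // _; exact: sqr_sign1. Qed.

(** Up to sign [y] is its own inverse, so multiplying by it once more undoes it. This is why
    correcting generators by one another loses nothing of the generated algebra. *)
Lemma adjoin_divr s x y :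
  sqr_sign y -> adjoin s y -> adjoin s (x * y) -> adjoin s x.
Proof.
move=> /sqr_signP[b yy] sy /adjoinM /(_ sy); rewrite -mulrA yy commr_sign.
exact: adjoin_signM.
Qed.

Lemma adjoin_divl s x y :
  sqr_sign x -> adjoin s x -> adjoin s (x * y) -> adjoin s y.
Proof.
move=> /sqr_signP[b xx] sx /(adjoinM sx); rewrite mulrA xx.
exact: adjoin_signM.
Qed.

(** The products over the subfamilies of [s] always span, so the dimension condition expresses that
    they form a basis. *)
Definition sign_system s :=
  [/\ {in s, forall x, sqr_sign x}, {in s &, forall x y, pm_comm x y},
      forall x, adjoin s x & \dim {:A} = (2 ^ size s)%N].

End SignCommutation.

(** * Symplectic Gram-Schmidt for sign systems *)

Section NormalForm.

Variables (F : fieldType) (A : falgType F).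
Implicit Types (s c z : seq A) (x y w g h : A).

(* w plays the role of the product of the anticommuting family c, which has   *)
(* even size: since w anticommutes with c, an anticommuting pair g, h that    *)
(* commutes with c can be replaced by w * g, w * h and added to c, and the    *)
(* new w is w * g * h.                                                        *)
Lemma anticommuting_extension s c w :
    all (@sqr_sign F A) (c ++ s) -> sqr_sign w -> pairwise (sign_comm true) c ->
    {in c, forall x, sign_comm true w x} ->
    {in s &, forall x y, pm_comm x y} ->
    {in s & c, forall x y, sign_comm false x y} ->
    {in s, forall x, sign_comm false w x} ->
    adjoin c w -> (forall x, adjoin (c ++ s) x) ->
  exists c' z, [/\ (size (c' ++ z) = size (c ++ s))%N,
    all (@sqr_sign F A) (c' ++ z), pairwise (sign_comm true) c',
    {in z & z ++ c', forall x y, GRing.comm x y} &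
    forall x, adjoin (c' ++ z) x].
Proof.
have [n] := ubnP (size s); elim: n s c w => // n IHn s c w.
rewrite ltnS all_cat => lesn /andP[/allP c_sq /allP s_sq] w_sq.
move=> c_anti wc ss sc ws cw gen.
have [s_comm|] := boolP (all2rel (sign_comm false) s).
  exists c, s; split=> //; first by rewrite all_cat; apply/andP; split; apply/allP.
  move=> x y sx; rewrite mem_cat => /orP[sy|cy]; apply/sign_commFP; last exact: sc.
  by move/allrelP: s_comm; apply.
case/allPn=> g sg /allPn[h sh gh_ncomm].
have gh : sign_comm true g h.
  by have := ss g h sg sh; rewrite /pm_comm (negPf gh_ncomm).
have gPh : h \in rem g s.
  have := perm_mem (perm_to_rem sg) h; rewrite sh inE => /esym/orP[/eqP hg|//].
  by rewrite hg sign_comm_refl in gh_ncomm.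
have s_perm : perm_eq s [:: g, h & rem h (rem g s)].
  apply: perm_trans (perm_to_rem sg) _; rewrite perm_cons; exact: perm_to_rem.
set t := rem h (rem g s) in s_perm.
have ts x : x \in t -> x \in s by rewrite (perm_mem s_perm) !inE => ->; rewrite !orbT.
(* A factor [g] flips the sign against [h] only, and a factor [h] flips the sign against [g] only.
   Hence [adj x] commutes with both. *)
pose adj x := x * g ^+ (~~ sign_comm false x h) * h ^+ (~~ sign_comm false x g).
have sq_g := s_sq g sg; have sq_h := s_sq h sh.
have comm_neg x y : pm_comm x y -> sign_comm (~~ sign_comm false x y) x y.
  by rewrite /pm_comm; case: (boolP (sign_comm false x y)).
have hg := sign_comm_sym gh.
have adj_g x : x \in s -> sign_comm false (adj x) g.
  move=> sx; have := sign_commMl (sign_commMl (comm_neg _ _ (ss x g sx sg))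
    (sign_commXl (~~ sign_comm false x h) (sign_comm_refl g)))
    (sign_commXl (~~ sign_comm false x g) hg).
  by rewrite andbF andbT addbF addbb.
have adj_h x : x \in s -> sign_comm false (adj x) h.
  move=> sx; have := sign_commMl (sign_commMl (comm_neg _ _ (ss x h sx sh))
    (sign_commXl (~~ sign_comm false x h) gh))
    (sign_commXl (~~ sign_comm false x g) (sign_comm_refl h)).
  by rewrite andbF andbT addbb.
have adj_F x y : x \in s -> (forall u, u \in s -> sign_comm false u y) ->
    sign_comm false (adj x) y.
  move=> sx sy; have := sign_commMl (sign_commMl (sy x sx)
    (sign_commXl (~~ sign_comm false x h) (sy g sg)))
    (sign_commXl (~~ sign_comm false x g) (sy h sh)).
  by rewrite !andbF.
have adj_pm x y : x \in s -> (forall u, u \in s -> pm_comm u y) ->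
    pm_comm (adj x) y.
  by move=> sx sy; apply: pm_commMl; first apply: pm_commMl; rewrite ?pm_commXl ?sy.
have adj_w x : x \in s -> sign_comm false (adj x) w.
  by move=> sx; apply: adj_F => // u su; apply/sign_comm_sym/ws.
have adj_sq x : x \in s -> sqr_sign (adj x).
  move=> sx; apply: sqr_signM (sqr_signX _ sq_h) _.
    apply: sqr_signM (s_sq _ sx) (sqr_signX _ sq_g) _.
    by apply/pm_comm_sym/pm_commXl/ss.
  by apply/pm_comm_sym/pm_commXl/pm_comm_sym/pm_commMl; rewrite ?pm_commXl ?ss.
have wg := ws g sg; have wh := ws h sh.
have pmF x y : sign_comm false x y -> pm_comm x y by rewrite /pm_comm => ->.
have pmT x y : sign_comm true x y -> pm_comm x y by rewrite /pm_comm orbC => ->.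
have wg_sq : sqr_sign (w * g) by rewrite sqr_signM ?pmF.
have wh_sq : sqr_sign (w * h) by rewrite sqr_signM ?pmF.
have wghC x b b' b'' : sign_comm b w x -> sign_comm b' g x -> sign_comm b'' h x ->
    sign_comm (b (+) b' (+) b'') (w * g * h) x.
  by move=> wx gx hx; apply: sign_commMl hx; apply: sign_commMl.
have gw := sign_comm_sym wg; have hw := sign_comm_sym wh.
(* The new members [w * g] and [w * h] anticommute because [g] and [h] do and [w] commutes with
   both. The family gains two members while [t] is two shorter than [s], so the total size is
   kept. *)
have [||||||||||c' [z [sz c'_sq c'_anti c'_comm c'_gen]]] :=
  IHn (map adj t) [:: w * g, w * h & c] (w * g * h).
- rewrite size_map; apply: leq_trans lesn.
  by rewrite (perm_size s_perm) /= ltnW.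
- rewrite /= wg_sq wh_sq /= all_cat; apply/andP; split; first exact/allP.
  by apply/allP=> _ /mapP[x tx ->]; apply/adj_sq/ts.
- by apply: sqr_signM => //; apply: pm_commMl; [exact: pmF | exact: pmT].
- rewrite /= c_anti andbT -andbA; apply/and3P; split.
  + have := sign_commMl (sign_commMr (sign_comm_refl w) wh) (sign_commMr gw gh).
    exact.
  + apply/allP=> x cx; exact: (sign_commMl (wc x cx) (sc g x sg cx)).
  + apply/allP=> x cx; exact: (sign_commMl (wc x cx) (sc h x sh cx)).
- move=> x; rewrite !inE => /or3P[/eqP->|/eqP->|cx].
  + exact: (sign_commMr (wghC w _ _ _ (sign_comm_refl w) gw hw)
                        (wghC g _ _ _ wg (sign_comm_refl g) hg)).
  + exact: (sign_commMr (wghC w _ _ _ (sign_comm_refl w) gw hw)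
                        (wghC h _ _ _ wh gh (sign_comm_refl h))).
  + exact: wghC (wc x cx) (sc g x sg cx) (sc h x sh cx).
- move=> _ _ /mapP[x /ts sx ->] /mapP[y /ts sy ->].
  apply: (adj_pm) => // u su; apply/pm_comm_sym/adj_pm => // v sv; exact: ss.
- move=> _ y /mapP[x /ts sx ->]; rewrite !inE => /or3P[/eqP->|/eqP->|cy].
  + exact: sign_commMr (adj_w x sx) (adj_g x sx).
  + exact: sign_commMr (adj_w x sx) (adj_h x sx).
  + by apply: adj_F => // u su; exact: sc.
- move=> _ /mapP[x /ts sx ->].
  apply: (wghC _ false false false); apply: sign_comm_sym;
    [exact: adj_w | exact: adj_g | exact: adj_h].
- have c1 x : x \in [:: w * g, w * h & c] -> adjoin [:: w * g, w * h & c] x.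
    exact: adjoin_mem.
  have w1 : adjoin [:: w * g, w * h & c] w.
    by apply: adjoin_sub cw => y cy; apply: c1; rewrite !inE cy !orbT.
  apply: adjoinM; first by apply: c1; rewrite mem_head.
  by apply: (adjoin_divl w_sq) => //; apply: c1; rewrite !inE eqxx orbT.
(* The old generators are recovered in turn: [w] from [c], then [g] and [h] by cancelling [w], then
   each [y] in [t] by cancelling powers of [h] and [g] in [adj y]. *)
- move=> x; apply: adjoin_sub (gen x) => y.
  set d := _ ++ map adj t; have dP u : u \in d -> adjoin d u by exact: adjoin_mem.
  have d_wgh u : u \in [:: w * g, w * h & c] -> adjoin d u.
    by move=> cu; apply: dP; rewrite /d mem_cat cu.
  have d_c u : u \in c -> adjoin d u.
    by move=> cu; apply: d_wgh; rewrite !inE cu !orbT.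
  have d_w : adjoin d w by apply: adjoin_sub cw => u; exact: d_c.
  have d_g : adjoin d g.
    by apply: (adjoin_divl w_sq) => //; apply: d_wgh; rewrite mem_head.
  have d_h : adjoin d h.
    by apply: (adjoin_divl w_sq) => //; apply: d_wgh; rewrite !inE eqxx orbT.
  rewrite mem_cat => /orP[/d_c //|]; rewrite (perm_mem s_perm) !inE.
  case/or3P=> [/eqP->|/eqP->|ty] //.
  apply: (adjoin_divr (sqr_signX (~~ sign_comm false y h) sq_g)); first exact: adjoinX.
  apply: (adjoin_divr (sqr_signX (~~ sign_comm false y g) sq_h)); first exact: adjoinX.
  by apply: dP; rewrite /d mem_cat orbC (map_f adj ty).
exists c', z; split=> //; rewrite sz !size_cat /= size_map (perm_size s_perm) /=.
by rewrite !addnS.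
Qed.

Lemma sign_system_normal_form s : sign_system s ->
  exists c z, [/\ (size c + size z = size s)%N,
    all (@sqr_sign F A) (c ++ z), pairwise (sign_comm true) c,
    {in z & z ++ c, forall x y, GRing.comm x y} & forall x, adjoin (c ++ z) x].
Proof.
case=> s_sq s_pm s_gen _.
(* The process starts from the empty anticommuting family, whose product is 1. *)
have [|||||||||c [z [sz ? ? ? ?]]] := @anticommuting_extension s [::] 1 => //.
- exact/allP.
- exact: sqr_sign1.
- by move=> x _; exact: sign_comm1l.
- exact: adjoin1.
by exists c, z; rewrite -size_cat sz.
Qed.

End NormalForm.

(** * Sign systems and morphisms on tensor products *)

Lemma sqr_sign_morph (F : fieldType) (A B : falgType F)
    (f : {lrmorphism A -> B}) (x : A) : sqr_sign x -> sqr_sign (f x).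
Proof.
move=> /sqr_signP[b xx]; apply/sqr_signP; exists b.
by rewrite -rmorphM xx rmorph_sign.
Qed.

Lemma pm_comm_morph (F : fieldType) (A B : falgType F)
    (f : {lrmorphism A -> B}) (x y : A) : pm_comm x y -> pm_comm (f x) (f y).
Proof.
move=> /pm_commP[b /eqP xy]; apply/pm_commP; exists b; apply/eqP.
by rewrite -rmorphM xy !rmorphM rmorph_sign.
Qed.

Section TensorSystem.

Variables (F : fieldType) (A B : falgType F).
Local Notation "u [*] v" := (@pure_tensor F A B u v) (at level 40).

Definition tensor_inl (u : A) : tensor A B := u [*] 1.
Definition tensor_inr (v : B) : tensor A B := 1 [*] v.

Lemma tensor_inl_linear : linear tensor_inl.
Proof. by move=> a u v; exact: pure_linear_l. Qed.

Lemma tensor_inr_linear : linear tensor_inr.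
Proof. by move=> a u v; exact: pure_linear_r. Qed.

Lemma tensor_inl_monoid : monoid_morphism tensor_inl.
Proof. by split=> // u v; rewrite /tensor_inl pure_tensorM mulr1. Qed.

Lemma tensor_inr_monoid : monoid_morphism tensor_inr.
Proof. by split=> // u v; rewrite /tensor_inr pure_tensorM mulr1. Qed.

HB.instance Definition _ :=
  GRing.isLinear.Build F A (tensor A B) *:%R tensor_inl tensor_inl_linear.
HB.instance Definition _ :=
  GRing.isLinear.Build F B (tensor A B) *:%R tensor_inr tensor_inr_linear.
HB.instance Definition _ :=
  GRing.isMonoidMorphism.Build A (tensor A B) tensor_inl tensor_inl_monoid.
HB.instance Definition _ :=
  GRing.isMonoidMorphism.Build B (tensor A B) tensor_inr tensor_inr_monoid.

Lemma tensor_inlr_pure u v : tensor_inl u * tensor_inr v = u [*] v.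
Proof. by rewrite pure_tensorM mulr1 mul1r. Qed.

Lemma tensor_inrl_pure u v : tensor_inr v * tensor_inl u = u [*] v.
Proof. by rewrite pure_tensorM mulr1 mul1r. Qed.

(** Members coming from different factors commute, pure tensors span, and dimensions multiply while
    sizes add. *)
Lemma tensor_sign_system (s : seq A) (t : seq B) :
  sign_system s -> sign_system t ->
  sign_system (map tensor_inl s ++ map tensor_inr t).
Proof.
case=> s_sq s_pm s_gen s_dim [t_sq t_pm t_gen t_dim]; split.
- by move=> _ /[!mem_cat]/orP[]/mapP[x sx ->]; apply: sqr_sign_morph; auto.
- have lr u v : sign_comm false (tensor_inl u) (tensor_inr v).
    by apply/sign_commFP; rewrite /GRing.comm tensor_inlr_pure tensor_inrl_pure.
  move=> _ _ /[!mem_cat]/orP[]/mapP[x sx ->]/orP[]/mapP[y sy ->].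
  + by apply: pm_comm_morph; exact: s_pm.
  + by apply/pm_commP; exists false.
  + by apply/pm_commP; exists false; exact: sign_comm_sym.
  + by apply: pm_comm_morph; exact: t_pm.
- move=> M; rewrite (tensor_coord_sum M); apply: adjoin_sum => k.
  apply: adjoinZ; rewrite /tensor_basis -tensor_inlr_pure; apply: adjoinM.
  + apply: adjoin_sub (adjoin_morph tensor_inl (s_gen _)) => y sy.
    by apply: adjoin_mem; rewrite mem_cat sy.
  + apply: adjoin_sub (adjoin_morph tensor_inr (t_gen _)) => y ty.
    by apply: adjoin_mem; rewrite mem_cat ty orbT.
- by rewrite dim_tensor s_dim t_dim -expnD size_cat !size_map.
Qed.

(** Multiplicativity need only be checked on pure tensors, where it amounts to exchanging a value of
    [f] with a value of [g]. *)
Lemma tensor_lift_morph (C : falgType F) (f : {lrmorphism A -> C})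
    (g : {lrmorphism B -> C}) :
  (forall u v, GRing.comm (f u) (g v)) ->
  exists h : {lrmorphism tensor A B -> C}, forall u v, h (u [*] v) = f u * g v.
Proof.
move=> fg; have [||h hE] := @tensor_lift F A B C (fun u v => f u * g v).
- by move=> v a u u'; rewrite linearP mulrDl scalerAl.
- by move=> u a v v'; rewrite linearP mulrDr scalerAr.
have hM : monoid_morphism h.
  split=> [|M N]; first by rewrite -pure_tensor1 hE !rmorph1 mulr1.
  rewrite (tensor_coord_sum M) (tensor_coord_sum N) mulr_suml !linear_sum mulr_suml.
  apply: eq_bigr => k _; rewrite mulr_sumr mulr_sumr linear_sum.
  apply: eq_bigr => l _; rewrite -scalerAl -scalerAr !linearZ /= -scalerAl -scalerAr.
  rewrite /tensor_basis pure_tensorM !hE !rmorphM !mulrA; congr (_ *: (_ *: (_ * _))).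
  by rewrite -!mulrA; congr (_ * _); exact: fg.
exists (HB.pack_for {lrmorphism tensor A B -> C} (GRing.Linear.sort h)
  (GRing.isMonoidMorphism.Build (tensor A B) C h hM)).
exact: hE.
Qed.

End TensorSystem.

(** * Universal property of the sign algebras *)

Section SignAlgebraLift.

Variables (F : fieldType) (n : nat) (beta : rel 'I_n).
Hypothesis beta_tri : forall a b : 'I_n, (a < b)%N -> beta a b = false.
Implicit Types (a b : 'I_n) (s : seq 'I_n).

Local Notation ord_sorted := (sorted (relpre (@nat_of_ord n) ltn)).

Definition sign_relations (A : falgType F) (g : 'I_n -> A) :=
  (forall a, g a * g a = (-1) ^+ beta a a) /\
  (forall a b, g a * g b = (-1) ^+ (beta a b (+) beta b a) * (g b * g a)).

Lemma sign_gen_relations : sign_relations (sign_gen F beta).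
Proof.
split=> [a|a b]; first by rewrite sign_gen_sqr scaler_sign; case: (beta a a).
by rewrite {1}sign_gen_swap scaler_sign mulr_sign.
Qed.

Lemma ord_sorted_enum (B : {set 'I_n}) : ord_sorted (enum B).
Proof.
rewrite -sorted_map; apply: (@subseq_sorted _ ltn) (iota_ltn_sorted 0 n).
  exact: ltn_trans.
by rewrite -val_enum_ord map_subseq // enumT filter_subseq.
Qed.

Lemma ord_sorted_enum_set s : ord_sorted s -> enum [set a in s] = s.
Proof.
move=> s_sorted; apply: irr_sorted_eq (ord_sorted_enum _) s_sorted _.
- by move=> x y z; exact: ltn_trans.
- by move=> x; exact: ltnn.
by move=> a; rewrite mem_enum inE.
Qed.

(** Straightening a word by insertion uses the relations alone. The sign [b] and the word [s'] are
    therefore chosen before the algebra, so that the same rewriting serves in [sign_alg F beta] and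
    in the target of a lift. *)
Lemma gen_mul_sorted_prod a s : ord_sorted s ->
  exists (b : bool) s', [/\ ord_sorted s', {subset s' <= a :: s} &
    forall (A : falgType F) (g : 'I_n -> A), sign_relations g ->
    g a * \prod_(i <- s) g i = (-1) ^+ b * \prod_(i <- s') g i].
Proof.
elim: s => [_|c s IHs s_sorted].
  by exists false, [:: a]; split=> // A g _; rewrite big_nil big_seq1 mulr1 mul1r.
have [ac|ca|/val_inj ac] := ltngtP a c.
- exists false, [:: a, c & s]; split=> //; first by rewrite /= ac.
  by move=> A g _; rewrite mul1r [RHS]big_cons.
(* Here [g a] moves past [g c] and is inserted in the tail. The entries of [s'] come from [a :: s],
   all above [c], so [c] can be put back in front. *)
- have [b [s' [s'_sorted s's s'E]]] := IHs (path_sorted s_sorted).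
  exists ((beta a c (+) beta c a) (+) b), (c :: s'); split.
  + rewrite /= path_min_sorted //; apply/allP => d /s's; rewrite inE.
    case/orP=> [/eqP->//|sd].
    by apply: (allP (order_path_min _ s_sorted)) sd => x y z; exact: ltn_trans.
  + move=> d; rewrite !inE => /orP[->|/s's]; first by rewrite orbT.
    by rewrite inE => /orP[->|->]; rewrite ?orbT.
  + move=> A g rel; rewrite !big_cons mulrA rel.2 -!mulrA (s'E A g rel).
    by rewrite mulr_signCA mulrA -!signr_addb.
- exists (beta a a), s; split=> //; first exact: path_sorted s_sorted.
    by move=> d sd; rewrite !inE sd !orbT.
  by move=> A g rel; rewrite big_cons -ac mulrA rel.1.
Qed.

(** The basis dictates the linear map, sending a blade to the ordered product of the [g a]. It
    respects left multiplication by a generator because straightening is the same on both sides, and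
    blades are products of generators. *)
Lemma sign_alg_lift (A : falgType F) (g : 'I_n -> A) : sign_relations g ->
  exists f : {lrmorphism sign_alg F beta -> A}, forall a, f (sign_gen F beta a) = g a.
Proof.
move=> g_rel.
have [f f_blade] : exists f : {linear sign_alg F beta -> A},
    forall B, f (blade F beta B) = \prod_(a <- enum B) g a.
  pose f0 (x : sign_alg F beta) : A :=
    \sum_B blade_coord x B *: \prod_(a <- enum B) g a.
  have f0L : linear f0.
    move=> a x y; rewrite /f0 scaler_sumr -big_split; apply: eq_bigr => B _ /=.
    by rewrite blade_coord_linear scalerDl scalerA.
  exists (HB.pack_for {linear sign_alg F beta -> A} f0
    (GRing.isLinear.Build F (sign_alg F beta) A *:%R f0 f0L)) => B.
  rewrite -[LHS]/(f0 _) /f0 (bigD1 B) //= blade_coord_blade eqxx scale1r.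
  rewrite [X in _ + X]big1 ?addr0 // => C CB.
  by rewrite blade_coord_blade eq_sym (negPf CB) scale0r.
have f_sorted s : ord_sorted s ->
    f (\prod_(a <- s) sign_gen F beta a) = \prod_(a <- s) g a.
  by move=> /ord_sorted_enum_set <-; rewrite -blade_prod ?f_blade.
have f_genM a x : f (sign_gen F beta a * x) = g a * f x.
  rewrite (blade_coord_sum x) mulr_sumr !linear_sum mulr_sumr.
  apply: eq_bigr => B _; rewrite -scalerAr !linearZ /= -scalerAr; congr (_ *: _).
  rewrite blade_prod // (f_sorted _ (ord_sorted_enum B)).
  have [b [s' [s'_sorted _ s'E]]] := gen_mul_sorted_prod a (ord_sorted_enum B).
  rewrite (s'E A g g_rel) (s'E (sign_alg F beta) _ sign_gen_relations).
  by rewrite !mulr_sign; case: b {s'E} => /=; rewrite ?linearN f_sorted.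
have f1 : f 1 = 1 by rewrite -blade0 f_blade enum_set0 big_nil.
have fM : monoid_morphism f.
  split=> // x y; rewrite (blade_coord_sum x) mulr_suml !linear_sum mulr_suml.
  apply: eq_bigr => B _; rewrite -scalerAl !linearZ /= -scalerAl; congr (_ *: _).
  rewrite blade_prod //; elim: (enum B) => [|a s IHs].
    by rewrite big_nil mul1r f1 mul1r.
  by rewrite big_cons -mulrA !f_genM IHs mulrA.
exists (HB.pack_for {lrmorphism sign_alg F beta -> A} (GRing.Linear.sort f)
  (GRing.isMonoidMorphism.Build (sign_alg F beta) A f fM)).
by move=> a; rewrite -[sign_gen F beta a]mulr1 /= f_genM f1 mulr1.
Qed.

Lemma sign_alg_system :
  sign_system [seq sign_gen F beta a | a <- enum 'I_n].
Proof.
have [gen_sq gen_sw] := sign_gen_relations; split.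
- by move=> _ /mapP[a _ ->]; apply/sqr_signP; exists (beta a a).
- move=> _ _ /mapP[a _ ->] /mapP[b _ ->]; apply/pm_commP.
  by exists (beta a b (+) beta b a); apply/eqP.
- move=> x; rewrite (blade_coord_sum x); apply: adjoin_sum => B.
  apply: adjoinZ; rewrite blade_prod //; apply: adjoin_prod => a.
  by apply: adjoin_mem; rewrite map_f ?mem_enum.
- by rewrite dim_sign_alg size_map size_enum_ord.
Qed.

End SignAlgebraLift.

(** * Clifford and commutative algebras: lifting and sign systems *)

Section CliffordLift.

Variables (F : fieldType) (p q : nat).

Lemma clifford_sign_tri (a b : 'I_(p + q)) :
  (a < b)%N -> @clifford_sign p q a b = false.
Proof.
move=> ab; rewrite /clifford_sign ltnNge ltnW //=.
by case: eqP ab => // ->; rewrite ltnn.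
Qed.

Lemma commutative_sign_tri (a b : 'I_(p + q)) :
  (a < b)%N -> @commutative_sign p q a b = false.
Proof. by rewrite /commutative_sign => ab; case: eqP ab => // ->; rewrite ltnn. Qed.

Lemma clifford_lift (A : falgType F) (g : 'I_(p + q) -> A) :
  (forall a, g a * g a = (-1) ^+ (p <= a)%N) ->
  (forall a b : 'I_(p + q), (a < b)%N -> sign_comm true (g a) (g b)) ->
  exists f : {lrmorphism clifford F p q -> A}, forall a, f (clifford_gen F a) = g a.
Proof.
move=> g_sq g_anti; apply: (sign_alg_lift clifford_sign_tri); split=> [a|a b].
  by rewrite g_sq /clifford_sign ltnn eqxx.
have [ab|ba|/val_inj->] := ltngtP a b.
- rewrite (clifford_sign_tri ab) /clifford_sign ab.
  by rewrite (eqP (g_anti a b ab)).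
- rewrite (clifford_sign_tri ba) /clifford_sign ba.
  by rewrite (eqP (sign_comm_sym (g_anti b a ba))).
- by rewrite addbb mul1r.
Qed.

Lemma kalg_lift (A : falgType F) (g : 'I_(p + q) -> A) :
  (forall a, g a * g a = (-1) ^+ (p <= a)%N) ->
  (forall a b, GRing.comm (g a) (g b)) ->
  exists f : {lrmorphism kalg F p q -> A}, forall a, f (kalg_gen F a) = g a.
Proof.
move=> g_sq g_comm; apply: (sign_alg_lift commutative_sign_tri); split=> [a|a b].
  by rewrite g_sq /commutative_sign eqxx.
rewrite /commutative_sign [b == a]eq_sym; case: eqP => [->|_].
  by rewrite addbb mul1r.
by rewrite mul1r; exact: g_comm.
Qed.

Lemma clifford_sign_system : sign_system (map (@clifford_gen F p q) (enum 'I_(p + q))).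
Proof. exact: (sign_alg_system F clifford_sign_tri). Qed.

Lemma kalg_sign_system : sign_system (map (@kalg_gen F p q) (enum 'I_(p + q))).
Proof. exact: (sign_alg_system F commutative_sign_tri). Qed.

End CliffordLift.

Lemma ext_clifford_sign_system (F : fieldType) (r s p q : nat) :
  exists2 t : seq (ext_clifford F r s p q), size t = (r + s + p + q)%N & sign_system t.
Proof.
exists (map (@tensor_inl F _ _) (map (@kalg_gen F r s) (enum 'I_(r + s))) ++
        map (@tensor_inr F _ _) (map (@clifford_gen F p q) (enum 'I_(p + q)))).
  by rewrite size_cat !size_map -!enumT !size_enum_ord addnA.
exact: tensor_sign_system (kalg_sign_system F r s) (clifford_sign_system F p q).
Qed.

Lemma tensor_iter_sign_system (F : fieldType) (k : nat) (n : 'I_k.+1 -> nat)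
    (A : 'I_k.+1 -> falgType F) :
  (forall j, exists2 t : seq (A j), size t = n j & sign_system t) ->
  exists2 t : seq (tensor_iter A), size t = (\sum_(j < k.+1) n j)%N & sign_system t.
Proof.
elim: k n A => [|k IHk] n A An; first by rewrite big_ord1; exact: An.
have [j|s ss s_sys] :=
  IHk (fun j => n (widen_ord (leqnSn _) j)) (fun j => A (widen_ord (leqnSn _) j)).
  exact: An.
have [t tt t_sys] := An ord_max.
exists (map (@tensor_inl F _ _) s ++ map (@tensor_inr F _ _) t).
  by rewrite big_ord_recr /= size_cat !size_map ss tt.
exact: tensor_sign_system.
Qed.

(** * Recognising extended Clifford algebras *)

(** By rank-nullity the kernel is zero. The inverse is what is returned because universal properties
    give maps out of the extended Clifford algebra, while the theorem asks for a map into it. *)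
Lemma surjective_lrmorphism_inverse (F : fieldType) (A B : falgType F)
    (f : {lrmorphism A -> B}) :
  \dim {:A} = \dim {:B} -> (forall y, exists x, f x = y) ->
  exists g : {lrmorphism B -> A}, bijective g.
Proof.
move=> dimAB f_surj; pose fl := linfun f.
have limgE : limg fl = fullv.
  apply/vspaceP=> y; rewrite memvf; have [x <-] := f_surj y.
  by rewrite -[f x](lfunE f) memv_img ?memvf.
have ker0 : lker fl == 0%VS.
  rewrite -dimv_eq0 -(capfv (lker fl)) -(eqn_add2r (\dim (limg fl))).
  by rewrite limg_ker_dim limgE dimAB.
have fK : cancel f fl^-1%VF.
  by move=> x; rewrite -[f x](lfunE f) (lker0_lfunK ker0).
have [g [gL gK fgK]] : exists g : B -> A, [/\ linear g, cancel g f & cancel f g].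
  exists fl^-1%VF; split=> [a x y|y|//]; first exact: linearP.
  by rewrite -[f _](lfunE f) limg_lfunVK // limgE memvf.
have gM : monoid_morphism g.
  by split=> [|x y]; apply: (can_inj fgK); rewrite ?rmorphM ?rmorph1 /= !gK.
exists (HB.pack_for {lrmorphism B -> A} g
  (GRing.isLinear.Build F B A *:%R g gL) (GRing.isMonoidMorphism.Build B A g gM)).
by exists f.
Qed.

(** The signature convention wants the elements of square 1 first. Reordering may reverse a pair,
    hence the restriction to symmetric [r]. *)
Lemma seq_sqr_sign_split (F : fieldType) (A : falgType F) (s : seq A) :
  all (@sqr_sign F A) s ->
  exists p q (g : 'I_(p + q) -> A), [/\ (p + q = size s)%N,
    forall a, g a * g a = (-1) ^+ (p <= a)%N,
    forall x, (x \in s) = (x \in codom g) &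
    forall r : rel A, symmetric r -> pairwise r s ->
      forall a b : 'I_(p + q), (a < b)%N -> r (g a) (g b)].
Proof.
move=> /allP s_sq; pose P (x : A) := x * x == 1.
pose s' := filter P s ++ filter (predC P) s.
have s's : s' =i s by move=> x; rewrite (perm_mem (permEl (perm_filterC P s))).
have size_s' : (size (filter P s) + size (filter (predC P) s) = size s)%N.
  by rewrite -size_cat (perm_size (permEl (perm_filterC P s))).
exists (size (filter P s)), (size (filter (predC P) s)), (fun i => nth 0 s' i).
have lt_s' (a : 'I_(size (filter P s) + size (filter (predC P) s))) : (a < size s')%N.
  by rewrite size_cat.
split=> // [a|x|r r_sym].
- rewrite nth_cat ltnNge; case: leqP => [pa|ap] /=.
  + have: nth 0 (filter (predC P) s) (a - size (filter P s)) \in filter (predC P) s.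
      by apply: mem_nth; rewrite ltn_subLR.
    rewrite mem_filter /= => /andP[/negPf P_nth /s_sq].
    by rewrite /sqr_sign [_ == 1]P_nth => /eqP.
  + have: nth 0 (filter P s) a \in filter P s by exact: mem_nth.
    by rewrite mem_filter => /andP[/eqP].
- rewrite -s's; apply/idP/codomP => [/(nthP 0)[i i_lt <-]|[a ->]]; last exact: mem_nth.
  by move: i_lt; rewrite size_cat => i_lt; exists (Ordinal i_lt).
- move=> s_pair a b ab; apply: (pairwiseP 0 _) ab; rewrite ?inE ?lt_s' //.
  rewrite pairwise_cat !pairwise_filter // !andbT.
  (* Only pairs with one entry from each part remain. Their squares differ, so they sit at distinct
     positions of [s], in either order. *)
  apply/allrelP=> x y; rewrite !mem_filter => /andP[Px sx] /andP[Py sy].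
  have xy : x != y by apply: contraTneq Px => ->.
  have [ltxy|ltyx|/eqP] := ltngtP (index x s) (index y s).
  + by have := pairwiseP 0 s_pair _ _ _ _ ltxy;
      rewrite !inE !index_mem !nth_index //; apply.
  + by rewrite r_sym; have := pairwiseP 0 s_pair _ _ _ _ ltyx;
      rewrite !inE !index_mem !nth_index //; apply.
  + by move/eqP/index_inj=> /(_ x sx sy) exy; rewrite exy eqxx in xy.
Qed.

Lemma sign_system_ext_clifford (F : fieldType) (A : falgType F) (t : seq A) :
  sign_system t ->
  exists r s p q, (r + s + p + q = size t)%N /\
    exists f : {lrmorphism A -> ext_clifford F r s p q}, bijective f.
Proof.
move=> t_sys; have [c [z [sz]]] := sign_system_normal_form t_sys.
have [_ _ _ t_dim] := t_sys.
rewrite all_cat => /andP[c_sq z_sq] c_anti z_comm gen.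
have [p [q [g [pq g_sq gE g_pair]]]] := seq_sqr_sign_split c_sq.
have [r [s [h [rs h_sq hE h_pair]]]] := seq_sqr_sign_split z_sq.
have gc a : g a \in c by rewrite gE codom_f.
have hz a : h a \in z by rewrite hE codom_f.
have [|u uE] := clifford_lift g_sq.
  by apply: g_pair => // x y; apply/idP/idP; exact: sign_comm_sym.
have [|v vE] := kalg_lift h_sq.
  by move=> a b; apply: z_comm; rewrite ?mem_cat hz.
exists r, s, p, q; split; first by rewrite -addnA pq rs addnC.
(* Commutation of the two images is reduced to generators, first in [y] and then in [x]; there it
   holds because [z] commutes with [c]. *)
have uv x y : GRing.comm (v x) (u y).
  have [_ _ K_gen _] := kalg_sign_system F r s.
  have [_ _ C_gen _] := clifford_sign_system F p q.
  apply: adjoin_comm (adjoin_morph u (C_gen y)) => _ /mapP[_ /mapP[b _ ->] ->].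
  apply: commr_sym.
  apply: adjoin_comm (adjoin_morph v (K_gen x)) => _ /mapP[_ /mapP[a _ ->] ->].
  by apply: commr_sym; rewrite uE vE; apply: z_comm; rewrite // mem_cat gc orbT.
have [w wE] := tensor_lift_morph uv.
apply: (@surjective_lrmorphism_inverse F _ A w).
  by rewrite dim_tensor dim_clifford dim_kalg -expnD rs pq t_dim addnC sz.
move=> y; elim: (gen y) => [|x|a _ _ _ [x <-] _ [x' <-]|_ _ _ [x <-] _ [x' <-]].
- by exists 1; rewrite rmorph1.
- rewrite mem_cat gE hE => /orP[]/codomP[a ->].
  + by exists (pure_tensor 1 (clifford_gen F a)); rewrite wE rmorph1 mul1r uE.
  + by exists (pure_tensor (kalg_gen F a) 1); rewrite wE rmorph1 mulr1 vE.
- by exists (a *: x + x'); rewrite linearP.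
- by exists (x * x'); rewrite rmorphM.
Qed.

Theorem mainTheorem2 (R : realType) (k : nat)
    (rj sj pj qj : 'I_k.+1 -> nat) :
  exists r s p q : nat,
    (r + s + p + q = \sum_(j < k.+1) (rj j + sj j + pj j + qj j))%N /\
    exists f : {lrmorphism
        tensor_iter (fun j => ext_clifford R (rj j) (sj j) (pj j) (qj j)) ->
        ext_clifford R r s p q},
      bijective f.
Proof.
have [j|t tt t_sys] := @tensor_iter_sign_system R k
  (fun j => rj j + sj j + pj j + qj j)%N
  (fun j => ext_clifford R (rj j) (sj j) (pj j) (qj j)).
  exact: ext_clifford_sign_system.
by rewrite -tt; exact: sign_system_ext_clifford.
Qed.
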